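(* Let $n\ge 2$, $\alpha\in(0,1]$, $\beta\in(0,2n-2]$, and let $E\subset\mathbb{R}^n$ be an $(\alpha,\beta)$-Furstenberg set. Then $$\dim_{\mathrm H}(E)\ge\alpha+\min\{\beta,\alpha\}.$$
   Context: $\dim_{\mathrm H}$ is Hausdorff dimension and $\mathcal{H}^s$ is $s$-dimensional Hausdorff (outer) measure. $A(n,1)$ is the $(2n-2)$-dimensional manifold of affine lines in $\mathbb{R}^n$, with metric $d(\ell_1,\ell_2)=|e_1-e_2|+|v_1-v_2|$, where $\ell_i=\{te_i+v_i:t\in\mathbb{R}\}$, $e_i\in S^{n-1}$, $v_i\in e_i^\perp$, and the signs of $e_1,e_2$ are chosen to minimize $|e_1-e_2|$. A set $E\subset\mathbb{R}^n$ (not necessarily measurable) is an $(\alpha,\beta)$-Furstenberg set if there exists a set of lines $L\subset A(n,1)$ with $\mathcal{H}^\beta(L)>0$ (Hausdorff measure with respect to $d$) such that $\mathcal{H}^\alpha(E\cap\omega)>0$ for all $\omega\in L$. *)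

(* Defs.v *)
From HB Require Import structures.
From mathcomp Require Import all_boot all_order all_algebra.
From mathcomp Require Import all_classical all_reals all_analysis.

Set Implicit Arguments.
Unset Strict Implicit.
Unset Printing Implicit Defensive.

Import Order.TTheory GRing.Theory Num.Theory.

Local Open Scope classical_set_scope.
Local Open Scope ring_scope.

(* Hausdorff measure and dimension are taken with respect to an explicit
   distance function [d]: the norm provided by the library on ['rV[R]_n] is
   the sup norm, and the lines carry no library metric. *)
Section Hausdorff.
Context {R : realType} {T : Type}.
Variable d : T -> T -> R.
Local Open Scope ereal_scope.

Definition diameter (U : set T) : \bar R :=
  ereal_sup [set (d x y)%:E | x in U & y in U].

(* Empty pieces contribute 0 to the sum (for every [s], including [s = 0]), so
   finite covers are allowed. A nonempty piece of diameter 0 contributes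
   [0 `^ 0 = 1] when [s = 0]: the 0-dimensional measure is counting measure. *)
Definition hausdorff_content (s delta : R) (A : set T) : \bar R :=
  ereal_inf [set \sum_(i <oo | U i != set0) poweR (diameter (U i)) s
            | U in [set U : (set T)^nat |
                A `<=` \bigcup_i U i /\
                forall i, diameter (U i) <= delta%:E]].

(* The content is nonincreasing in [delta], so this supremum is its limit as
   [delta] tends to 0 from the right. *)
Definition hausdorff_measure (s : R) (A : set T) : \bar R :=
  ereal_sup [set hausdorff_content s delta A
            | delta in [set delta : R | (0 < delta)%R]].

Definition hausdorff_dim (A : set T) : \bar R :=
  ereal_inf [set s%:E
            | s in [set s : R | (0 <= s)%R /\ hausdorff_measure s A = 0]].

End Hausdorff.

Section Lines.
Context {R : realType} {n : nat}.
Implicit Types e v x y : 'rV[R]_n.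

Definition dot_product x y : R := \sum_(i < n) x 0 i * y 0 i.

Definition eucl_norm x : R := Num.sqrt (dot_product x x).

Definition eucl_dist x y : R := eucl_norm (x - y).

Definition line_repr (l : set 'rV[R]_n) e v : Prop :=
  [/\ eucl_norm e = 1, dot_product e v = 0 & l = [set t *: e + v | t in [set: R]]].

End Lines.

Record affine_line (R : realType) (n : nat) := AffineLine {
  line_points : set 'rV[R]_n;
  line_pointsP : exists e v, line_repr line_points e v
}.

(* A line determines [v], and determines [e] up to sign; the infimum is
   therefore a minimum over the choices of signs of [e1] and [e2]. *)
Definition line_dist (R : realType) (n : nat) (l1 l2 : affine_line R n) : R :=
  inf [set r : R | exists e1 v1 e2 v2,
    [/\ line_repr (line_points l1) e1 v1,
        line_repr (line_points l2) e2 v2 &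
        r = eucl_dist e1 e2 + eucl_dist v1 v2]].

Definition furstenberg_set (R : realType) (n : nat) (alpha beta : R)
    (E : set 'rV[R]_n) : Prop :=
  exists L : set (affine_line R n),
    (0 < hausdorff_measure (@line_dist R n) beta L)%E /\
    forall w, L w ->
      (0 < hausdorff_measure eucl_dist alpha (E `&` line_points w))%E.

(* Main.v *)
(** If [H^s(E) = 0] with [s < alpha + gamma], [gamma = min(beta, alpha)], cover [E]
    by dyadic balls with small total [s]-mass. Each line of the family meets [E] in
    a set of positive [alpha]-content, so by pigeonholing twice there is one scale
    [delta = 2^-k] at which a subfamily of lines of [gamma]-content at least
    [tau^-k], up to constants, meets the part of [E] covered by the balls of radius
    [delta] in [alpha]-content at least [tau^-k]; here [tau > 1] is close to 1. A
    discrete Frostman lemma replaces the lines, and the points on each line, by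
    finite [delta]-separated sets with the right ball counts. Two lines at distance
    [r] have nearby points only in a ball of radius [O(delta / r)], hence share
    [O(r^-alpha)] balls. As [gamma <= alpha], summing over pairs of lines and
    applying Cauchy-Schwarz shows that at least about [delta^-(alpha + gamma)] balls
    of radius [delta] are needed, more than the [delta^-s] available. No
    measurability enters, since only covers and finite sets are used. *)

Require Import Defs.
From mathcomp Require Import all_boot all_order all_algebra.
From mathcomp Require Import all_classical all_reals all_analysis.
From mathcomp Require Import ring lra zify.

Set Implicit Arguments.
Unset Strict Implicit.
Unset Printing Implicit Defensive.

Import Order.TTheory GRing.Theory Num.Theory.
Import numFieldNormedType.Exports.

Local Open Scope classical_set_scope.
Local Open Scope ring_scope.

(** * Discrete Frostman lemma *)

Lemma exists_seq_max_size (T : Type) (Q : seq T -> Prop) (N : nat) :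
  (exists s, Q s) -> (forall s, Q s -> (size s <= N)%N) ->
  exists2 s, Q s & forall s', Q s' -> (size s' <= size s)%N.
Proof.
move=> [s0 Qs0] QN.
pose q i := `[< exists2 s, Q s & size s = i >].
have q0 : exists i, q i by exists (size s0); apply/asboolP; exists s0.
have qN i : q i -> (i <= N)%N by move/asboolP=> [s Qs <-]; exact: QN.
case: (ex_maxnP q0 qN) => i /asboolP[s Qs <-] smax.
by exists s => // s' Qs'; apply: smax; apply/asboolP; exists s'.
Qed.

Lemma ler_sum_uniq_sub (R : numDomainType) (T : eqType) (w : T -> R)
    (F G : seq T) :
  (forall x, 0 <= w x) -> uniq F -> {subset F <= G} ->
  \sum_(x <- F) w x <= \sum_(x <- G) w x.
Proof.
move=> w0; elim: F G => [|x F IH] G; first by rewrite big_nil sumr_ge0.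
move=> /= /andP[xF uF] sub.
have xG : x \in G by apply: sub; rewrite mem_head.
rewrite big_cons (perm_big _ (perm_to_rem xG)) big_cons lerD2l.
apply: IH => // y yF; have : y \in x :: rem x G.
  by rewrite -(perm_mem (perm_to_rem xG)); apply: sub; rewrite inE yF orbT.
by rewrite inE => /orP[/eqP yx|//]; rewrite -yx yF in xF.
Qed.

Lemma sum_count_swap (S T : Type) (r : S -> T -> bool) (F : seq S) (G : seq T) :
  \sum_(x <- F) count (r x) G = \sum_(y <- G) count (r^~ y) F.
Proof.
under eq_bigr do rewrite -sum1_count big_mkcond.
rewrite exchange_big; apply: eq_bigr => y _.
by rewrite -sum1_count [RHS]big_mkcond.
Qed.

(* With [b = 2 `^ s], smallness with constant [c] bounds an [s]-dimensional
   content by balls of dyadic radius at most 4; the factor 4 absorbs the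
   enlargement in the Vitali covering argument. *)
Definition small (R : realType) (V : normedModType R) (b c : R) (A : set V) :=
  exists2 D : set (V * nat),
    forall x, A x -> exists2 p, D p & `|p.1 - x| <= 4 * 2 ^- p.2 &
    forall F : seq (V * nat), uniq F -> (forall p, p \in F -> D p) ->
      \sum_(p <- F) b ^- p.2 <= c.

Section Small.
Variables (R : realType) (V : normedModType R).
Implicit Types (A B : set V) (b c : R).

Lemma small_bigcup b (c : nat -> R) C (A : nat -> set V) :
  0 < b -> (forall k, small b (c k) (A k)) ->
  (forall M, \sum_(k < M) c k <= C) -> small b C (\bigcup_k A k).
Proof.
move=> b0 /= sA cC.
have /choice[D DP] : forall k, exists D : set (V * nat),
    (forall x, A k x -> exists2 p, D p & `|p.1 - x| <= 4 * 2 ^- p.2) /\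
    forall F : seq (V * nat), uniq F -> (forall p, p \in F -> D p) ->
      \sum_(p <- F) b ^- p.2 <= c k.
  by move=> k; have [D D1 D2] := sA k; exists D.
exists (\bigcup_k D k) => [x [k _ Akx]|F uF FD].
  by have [p Dp px] := (DP k).1 x Akx; exists p => //; exists k.
have /choice[f fP] : forall p, exists k, p \in F -> D k p.
  move=> p; have [pF|pF] := boolP (p \in F).
    by have [k _ Dkp] := FD p pF; exists k.
  by exists 0%N.
pose M := \max_(p <- F) f p.
have fM p : p \in F -> (f p < M.+1)%N.
  by move=> pF; rewrite ltnS; exact: leq_bigmax_seq.
apply: le_trans (cC M.+1).
rewrite (partition_big (fun p => inord (f p) : 'I_M.+1) predT) //=.
apply: ler_sum => i _; rewrite -big_filter.
apply: (DP i).2; first exact: filter_uniq.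
move=> p; rewrite mem_filter => /andP[/eqP <- pF].
by rewrite inordK ?fM //; exact: fP.
Qed.

Lemma small_sub b c A B : A `<=` B -> small b c B -> small b c A.
Proof. by move=> AB [D D1 D2]; exists D => // x /AB /D1. Qed.

Lemma small_le b c c' A : c <= c' -> small b c A -> small b c' A.
Proof.
by move=> cc' [D D1 D2]; exists D => // F uF FD; apply: le_trans (D2 F uF FD) cc'.
Qed.

Lemma small_leb b b' c A : 0 < b -> b <= b' -> small b c A -> small b' c A.
Proof.
move=> b0 bb' [D D1 D2]; exists D => // F uF FD.
apply: le_trans (D2 F uF FD); apply: ler_sum => p _.
rewrite lef_pV2 ?posrE ?exprn_gt0 ?(lt_le_trans b0) //.
by rewrite lerXn2r // nnegrE ltW // (lt_le_trans b0).
Qed.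

(* A largest admissible [P] saturates, up to a factor 2, some ball around
   each point of [A]. A disjoint subfamily of the saturated balls, selected
   greedily by decreasing radius, covers [A] after enlargement. *)
Lemma discrete_frostman b c A k : 1 <= b -> 0 < c -> c <= 1 -> ~ small b c A ->
  exists P : seq V,
    [/\ uniq P, (forall p, p \in P -> A p), (size P)%:R <= b ^+ k,
     (forall x j, (j <= k)%N ->
        (count (fun p => `|x - p| <= 2 ^- j) P)%:R <= b ^+ (k - j)) &
     c / 2 * b ^+ k <= (size P)%:R].
Proof.
move=> b1 c0 c1 nsA.
have b0 : 0 < b by apply: lt_le_trans b1.
pose inb (q : V * nat) p := `|q.1 - p| <= 2 ^- q.2.
pose adm (P : seq V) := [/\ uniq P, (forall p, p \in P -> A p),
  (size P)%:R <= b ^+ k &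
  (forall x j, (j <= k)%N -> (count (inb (x, j)) P)%:R <= b ^+ (k - j))].
have bk i : 1 <= b ^+ i by rewrite exprn_ege1.
have [P [uP PA Pk Pcount] Pmax] : exists2 P, adm P &
    forall P', adm P' -> (size P' <= size P)%N.
  apply: (@exists_seq_max_size _ _ (Num.bound (b ^+ k))).
    by exists [::]; split => // [|x j _] /=; rewrite exprn_ge0 // ltW.
  move=> P [_ _ Pk _]; rewrite -(ler_nat R); apply: le_trans Pk _.
  by apply: ltW; apply: archi_boundP; rewrite exprn_ge0 // ltW.
exists P; split => //.
(* If the cap on the size of [P] blocks a further point, then [b ^+ k < size P + 1 <= 2 * size P]
   suffices, as [c <= 1]. Otherwise only the ball counts can block it. *)
have [Pbig|Psmall] := ltP (b ^+ k) ((size P).+1%:R).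
  have P1 : (1 <= size P)%N.
    by case: (size P) Pbig => // Pbig; have := bk k; rewrite leNgt Pbig.
  have : b ^+ k <= 2 * (size P)%:R.
    by apply: ltW; apply: lt_le_trans Pbig _; rewrite -natrM ler_nat; lia.
  have := bk k; nra.
pose sat (q : V * nat) :=
  (q.2 <= k)%N /\ b ^+ (k - q.2) <= 2 * (count (inb q) P)%:R.
have sat_has q : sat q -> exists2 p, p \in P & inb q p.
  move=> [qk qs]; apply/hasP; rewrite has_count -(ltr_nat R).
  by have := bk (k - q.2)%N; lra.
(* A point of [P] saturates its own ball of radius [2 ^- k]. Any other point of [A] would overfill
   some ball; as [b ^+ (k - j) >= 1], that ball already holds [m >= 1] points of [P], and
   [m + 1 <= 2 * m]. *)
have Asat a : A a -> exists2 q, sat q & inb q a.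
  move=> Aa; have [aP|aP] := boolP (a \in P).
    exists (a, k); last by rewrite /inb subrr normr0 invr_ge0 exprn_ge0.
    split => //=; rewrite subnn expr0.
    have : (1 <= count (inb (a, k)) P)%N.
      rewrite -has_count; apply/hasP; exists a => //.
      by rewrite /inb subrr normr0 invr_ge0 exprn_ge0.
    by rewrite -(ler_nat R); lra.
  apply: contrapT => noq.
  suff /Pmax : adm (a :: P) by rewrite /= ltnn.
  split => //=; first by rewrite aP.
    by move=> p; rewrite inE => /orP[/eqP->//|/PA].
  move=> x j jk; case: (boolP (inb (x, j) a)) => [ina|_]; last exact: Pcount.
  rewrite leNgt; apply/negP => big; apply: noq; exists (x, j) => //; split => //=.
  set m := count _ _ in big *.
  have m1 : (1 <= m)%N.
    by case: m big => // big; have := bk (k - j)%N; rewrite leNgt big.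
  by apply: ltW; apply: lt_le_trans big _; rewrite -natrM ler_nat; lia.
pose disj (G : seq (V * nat)) := (forall q, q \in G -> sat q) /\
  forall p, p \in P -> (count (inb^~ p) G <= 1)%N.
have disj_sum G : disj G -> (\sum_(q <- G) count (inb q) P <= size P)%N.
  move=> [_ Gd]; rewrite sum_count_swap -sum1_size !big_seq.
  exact: leq_sum.
have disj_size G : disj G -> (size G <= size P)%N.
  move=> dG; apply: leq_trans (disj_sum G dG); rewrite -sum1_size !big_seq.
  apply: leq_sum => q qG; rewrite -has_count; apply/hasP.
  by apply: sat_has; exact: dG.1.
(* Greedy selection, one radius at a time: at level [m] a longest list of balls of radius [2 ^- m]
   is added, so every rejected ball shares a point of [P] with a chosen one at least as large. *)
have vitali m : exists G, [/\ disj G, (forall q, q \in G -> (q.2 < m)%N) &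
    forall q, sat q -> (q.2 < m)%N -> exists2 q', q' \in G &
      (q'.2 <= q.2)%N /\ exists2 p, p \in P & inb q p && inb q' p].
  elim: m => [|m [G [dG Gm Gmeet]]]; first by exists [::]; split.
  have [G' [dG' G'm] G'max] : exists2 G', (disj (G' ++ G) /\
      forall q, q \in G' -> q.2 = m) & forall G'', (disj (G'' ++ G) /\
      forall q, q \in G'' -> q.2 = m) -> (size G'' <= size G')%N.
    apply: (@exists_seq_max_size _ _ (size P)); first by exists [::].
    move=> s [/disj_size + _]; rewrite size_cat; lia.
  exists (G' ++ G); split => //.
    move=> q; rewrite mem_cat => /orP[/G'm ->//|/Gm]; lia.
  move=> q sq; rewrite ltnS leq_eqVlt => /orP[/eqP qm|qm]; last first.
    have [q' q'G ?] := Gmeet q sq qm.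
    by exists q' => //; rewrite mem_cat q'G orbT.
  apply: contrapT => nomeet.
  suff /G'max : disj ((q :: G') ++ G) /\ forall q', q' \in q :: G' -> q'.2 = m.
    by rewrite /= ltnn.
  split; last by move=> q'; rewrite inE => /orP[/eqP->//|/G'm].
  split => [q'|p pP]; first by rewrite /= inE => /orP[/eqP->//|]; exact: dG'.1.
  rewrite cat_cons; have [qp|qp] := boolP (inb q p); last first.
    by rewrite /= (negbTE qp); exact: dG'.2.
  rewrite /= qp; suff -> : count (inb^~ p) (G' ++ G) = 0%N by [].
  apply/eqP; rewrite -leqn0 leqNgt -has_count; apply/hasP => -[q' q'G q'p].
  apply: nomeet; exists q' => //; split; last by exists p => //; rewrite qp.
  by move: q'G; rewrite mem_cat qm => /orP[/G'm->//|/Gm /ltnW].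
have [G [dG _ Gmeet]] := vitali k.+1.
have uG : uniq G.
  apply: count_mem_uniq => q; have [qG|qG] := boolP (q \in G); last first.
    by apply/count_memPn.
  have [p pP qp] := sat_has q (dG.1 q qG).
  apply/eqP; rewrite eqn_leq -has_count has_pred1 qG andbT.
  apply: leq_trans (dG.2 p pP); apply: sub_count => q' /= /eqP -> //.
(* Otherwise [G] would witness that [A] is small: going through the common point [p] and the centre
   of [q], the distance from [q'.1] to [a] is at most three radii of [q']. *)
have Gsum : c < \sum_(q <- G) b ^- q.2.
  rewrite ltNge; apply/negP => Gc; apply: nsA.
  exists [set q | q \in G] => [a Aa|F uF FG]; last first.
    apply: le_trans Gc; apply: ler_sum_uniq_sub => // q.
    by rewrite invr_ge0 exprn_ge0 // ltW.
  have [q sq qa] := Asat a Aa.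
  have [q' q'G [qq' [p pP /andP[qp q'p]]]] := Gmeet q sq sq.1.
  exists q' => //; rewrite /inb in qa qp q'p.
  have h : (2 : R) ^- q.2 <= 2 ^- q'.2.
    by rewrite lef_pV2 ?posrE ?exprn_gt0 // ler_eXn2l ?ltr1n.
  have -> : q'.1 - a = (q'.1 - p) + (p - q.1) + (q.1 - a).
    by rewrite !addrA !subrK.
  have t1 := ler_normD (q'.1 - p + (p - q.1)) (q.1 - a).
  have t2 := ler_normD (q'.1 - p) (p - q.1).
  rewrite distrC in qp; have h0 : 0 <= (2 : R) ^- q'.2 by rewrite invr_ge0 exprn_ge0.
  lra.
(* Saturation turns weights into point counts, and disjointness on [P] bounds the sum of these
   counts. *)
have : b ^+ k * \sum_(q <- G) b ^- q.2 <= 2 * (size P)%:R.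
  apply: le_trans (_ : 2 * (\sum_(q <- G) count (inb q) P)%:R <= _); last first.
    by rewrite ler_pM2l // ler_nat disj_sum.
  rewrite natr_sum !mulr_sumr big_seq [leRHS]big_seq; apply: ler_sum => q qG.
  have [qk qs] := dG.1 q qG.
  by apply: le_trans qs; rewrite expfB_cond // gt_eqF.
have := bk k; nra.
Qed.

End Small.

(** * Hausdorff measures and dyadic ball covers *)

Section Powers.
Variable R : realType.
Implicit Types (s x : R).

Lemma powR_halfX s j : (2 ^- j : R) `^ s = (2 `^ s) ^- j.
Proof.
by rewrite -powR_invn // powRAC powR_invn // powR_ge0.
Qed.

Lemma exists_halfX_lt x : 0 < x -> exists k, (2 : R) ^- k < x.
Proof.
move=> x0; exists (Num.bound x^-1).
rewrite -[ltRHS]invrK ltf_pV2 ?posrE ?exprn_gt0 ?invr_gt0 //.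
apply: (lt_trans (archi_boundP _)); first by rewrite invr_ge0 ltW.
by rewrite -natrX ltr_nat ltn_expl.
Qed.

Lemma sum_halfX M : \sum_(k < M) (2 : R) ^- k.+1 <= 1.
Proof.
suff -> : \sum_(k < M) (2 : R) ^- k.+1 = 1 - 2 ^- M.
  by rewrite gerBl invr_ge0 exprn_ge0.
elim: M => [|M IH]; first by rewrite big_ord0 expr0 invr1 subrr.
rewrite big_ord_recr /= IH exprS invfM.
by have : (2 : R) != 0 by []; move: (2 ^- M) => y h; field.
Qed.

Lemma powR2_ge1 s : 0 <= s -> 1 <= (2 : R) `^ s.
Proof. by move=> s0; rewrite -[leLHS](powRr0 2) ler_powR ?ler1n. Qed.

End Powers.

Section Hausdorff.
Variable R : realType.

Lemma diameter_le (T : Type) (d : T -> T -> R) (U : set T) (r : R) :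
  (forall x y, U x -> U y -> d x y <= r) -> (diameter d U <= r%:E)%E.
Proof.
by move=> dr; apply: ge_ereal_sup => _ [x Ux [y Uy <-]]; rewrite lee_fin dr.
Qed.

Lemma le_diameter (T : Type) (d : T -> T -> R) (U : set T) x y :
  U x -> U y -> ((d x y)%:E <= diameter d U)%E.
Proof. by move=> Ux Uy; apply: ereal_sup_ubound; exists x => //; exists y. Qed.

(** Each nonempty piece of an efficient cover is replaced by a ball about one of its points, with a
    power of 2 as radius. Half of [e] bounds the cover; the other half, spread as a geometric
    series, pays for pieces of diameter 0, which still need a ball of positive radius. *)
Lemma small_of_hausdorff_measure_eq0 (V : normedModType R) (d : V -> V -> R)
    (s e : R) (E : set V) :
  0 <= s -> (forall x y, `|x - y| <= d x y) -> hausdorff_measure d s E = 0 ->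
  0 < e -> small (2 `^ s) e E.
Proof.
move=> s0 dE H0 e0; have e20 : 0 < e / 2 by rewrite divr_gt0.
(* Mesh 1 keeps all diameters at most 1, so that the levels can be natural numbers. *)
have : (hausdorff_content d s 1 E < (e / 2)%:E)%E.
  apply: (@le_lt_trans _ _ 0%E); last by rewrite lte_fin.
  by rewrite -[leRHS]H0; apply: ereal_sup_ubound; exists 1 => //; exact: ltr01.
case/ereal_inf_lt => _ [U [EU U1] <-] sumU.
pose w i := fine (poweR (diameter d (U i)) s).
have UP i x : U i x ->
    [/\ 0 <= fine (diameter d (U i)) <= 1,
        diameter d (U i) = (fine (diameter d (U i)))%:E &
        poweR (diameter d (U i)) s = (w i)%:E].
  move=> Uix.
  have d0 : (0 <= diameter d (U i))%E.
    apply: le_trans (le_diameter d Uix Uix); rewrite lee_fin.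
    by apply: le_trans (dE x x).
  have dfin : diameter d (U i) \is a fin_num.
    by rewrite ge0_fin_numE // (le_lt_trans (U1 i)) // ltry.
  rewrite /w -(fineK dfin) poweR_EFin; split => //=.
  by rewrite -!lee_fin fineK // d0 U1.
have /choice[f fP] : forall i, exists q : V * nat, U i !=set0 ->
    (forall x, U i x -> `|q.1 - x| <= 4 * 2 ^- q.2) /\
    (2 `^ s) ^- q.2 <= w i + e / 2 * 2 ^- i.+1.
  move=> i; have [[x Uix]|U0] := pselect (U i !=set0); last first.
    by exists (0, 0%N) => /U0.
  have [/andP[d0 d1] dfin wE] := UP i x Uix.
  set r := fine (diameter d (U i)) in d0 d1 dfin.
  have xr y : U i y -> `|x - y| <= r.
    by move=> Uiy; apply: le_trans (dE x y) _; rewrite -lee_fin -dfin le_diameter.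
  have wr : w i = r `^ s by rewrite /w dfin poweR_EFin.
  have e2i : 0 < e / 2 * 2 ^- i.+1 by rewrite mulr_gt0 // invr_gt0 exprn_gt0.
  suff [k rk wk] : exists2 k, r <= 4 * 2 ^- k &
      (2 ^- k) `^ s <= w i + e / 2 * 2 ^- i.+1.
    exists (x, k) => _; split; last by rewrite -powR_halfX.
    by move=> y /xr xy; apply: le_trans xy rk.
  (* Here [r = 0]. For [s = 0] the piece has weight 1, which pays for a ball of level 0; for [s > 0]
     it has weight 0, and the ball must be small enough for the extra term. *)
  have [r0|r0] := leP r 0.
    have r0E : r = 0 by apply: le_anti; rewrite r0.
    have [sE|s_neq0] := eqVneq s 0.
      exists 0%N; first by rewrite r0E mulr_ge0 // invr_ge0 exprn_ge0.
      by rewrite wr sE !powRr0 lerDl ltW.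
    have {}s0 : 0 < s by rewrite lt_def s_neq0.
    have [k hk] := @exists_halfX_lt R ((e / 2 * 2 ^- i.+1) `^ s^-1) ltac:(by rewrite powR_gt0).
    exists k; first by rewrite r0E mulr_ge0 // invr_ge0 exprn_ge0.
    rewrite wr r0E powR0 ?gt_eqF // add0r.
    have -> : e / 2 * 2 ^- i.+1 = ((e / 2 * 2 ^- i.+1) `^ s^-1) `^ s.
      by rewrite -powRrM mulVf ?gt_eqF // powRr1 // ltW.
    apply: ge0_ler_powR; rewrite ?nnegrE ?powR_ge0 ?invr_ge0 ?exprn_ge0 //; exact: ltW.
  have exk : exists k, (2 : R) ^- k <= r.
    by have [k /ltW hk] := exists_halfX_lt r0; exists k.
  case: (ex_minnP exk) => k kr kmin; exists k.
    case: k kr kmin => [|k] kr kmin.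
      by rewrite expr0 invr1; apply: le_trans d1 _; lra.
    have : r < 2 ^- k by rewrite ltNge; apply/negP => /kmin; rewrite ltnn.
    rewrite exprS invfM => rk; apply: le_trans (ltW rk) _.
    by have : 0 <= (2 : R) ^- k by []; lra.
  rewrite wr; apply: le_trans (_ : r `^ s <= _); last by rewrite lerDl ltW.
  by apply: ge0_ler_powR; rewrite ?nnegrE ?invr_ge0 ?exprn_ge0 // ltW.
exists [set q | exists2 i, U i !=set0 & f i = q].
  move=> x /EU[i _ Uix]; have Ui0 : U i !=set0 by exists x.
  by exists (f i); [exists i|exact: (fP i Ui0).1].
move=> F uF FD.
have /choice[g gP] : forall q, exists i, q \in F -> U i !=set0 /\ f i = q.
  move=> q; have [/FD[i Ui fi]|_] := boolP (q \in F); first by exists i.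
  by exists 0%N.
have uG : uniq (map g F).
  rewrite map_inj_in_uniq // => q q' qF q'F gq.
  by rewrite -(gP q qF).2 -(gP q' q'F).2 gq.
pose M := (\max_(i <- map g F) i).+1.
have GM i : i \in map g F -> (i < M)%N.
  by move=> iG; rewrite ltnS; exact: leq_bigmax_seq.
have w0 i : 0 <= w i by rewrite fine_ge0 // poweR_ge0.
have sumw : \sum_(i < M | U i != set0) w i <= e / 2.
  rewrite -lee_fin -sumEFin; apply: le_trans (ltW sumU).
  apply: le_trans (nneseries_lim_ge M _); last by move=> i _ _; exact: poweR_ge0.
  rewrite big_mkord le_eqVlt; apply/orP; left; apply/eqP.
  by apply: eq_bigr => i /set0P[x Uix]; have [] := UP i x Uix.
apply: le_trans (_ : \sum_(i <- map g F) (w i + e / 2 * 2 ^- i.+1) <= _).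
  rewrite big_map [leLHS]big_seq [leRHS]big_seq; apply: ler_sum => q qF.
  by have [Ui {1}<-] := gP q qF; exact: (fP _ Ui).2.
apply: le_trans (_ : \sum_(i < M | U i != set0) (w i + e / 2 * 2 ^- i.+1) <= _).
  rewrite -(big_mkord (fun i => U i != set0) (fun i => w i + e / 2 * 2 ^- i.+1)).
  rewrite -big_filter; apply: ler_sum_uniq_sub => //.
    by move=> i; rewrite addr_ge0 // mulr_ge0 // ?invr_ge0 ?exprn_ge0 // ltW.
  move=> i iG; rewrite mem_filter mem_index_iota leq0n GM // !andbT.
  by move: iG => /mapP[q qF ->]; apply/set0P; exact: (gP q qF).1.
rewrite big_split /= [leRHS](splitr e) lerD // -mulr_sumr.
rewrite ler_piMr ?(ltW e20) //; apply: le_trans (sum_halfX _ M).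
by rewrite [leRHS](bigID (fun i : 'I_M => U i != set0)) /= lerDl sumr_ge0.
Qed.

(** Balls covering the image are pulled back along [f]: a ball of radius [4 * 2 ^- j] has a preimage
    in [L] of diameter at most [8 * C * 2 ^- j]. This serves both for points on a line and, through
    a parametrization, for sets of lines. *)
Lemma hausdorff_measure_le0 (T : Type) (d : T -> T -> R) (V : normedModType R)
    (f : T -> V) (s C : R) (L : set T) :
  0 < s -> 0 < C -> (forall x y, 0 <= d x y) ->
  (forall x y, L x -> L y -> d x y <= C * `|f x - f y|) ->
  (forall e, 0 < e -> small (2 `^ s) e (f @` L)) ->
  (hausdorff_measure d s L <= 0)%E.
Proof.
move=> s0 C0 d_ge0 df sL; apply: ge_ereal_sup => _ [delta /= delta0 <-].
apply/lee_addgt0Pr => e e0; rewrite add0e.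
have C80 : 0 < 8 * C by rewrite mulr_gt0.
pose K := (8 * C) `^ s; have K0 : 0 < K by rewrite powR_gt0.
(* The first bound absorbs the factor [K] lost on diameters. The second, applied to a single ball,
   forces each pulled back piece to have diameter at most [delta]. *)
pose e1 := Num.min (e / K) ((delta / (8 * C)) `^ s).
have e10 : 0 < e1 by rewrite lt_min divr_gt0 // powR_gt0 // divr_gt0.
have b0 : 0 < (2 : R) `^ s by rewrite powR_gt0.
have [D DL Dsum] := sL e1 e10.
(* Balls of one level have the same positive weight, so the bound on finite sums leaves only
   finitely many of them. *)
have Dcnt : countable D.
  suff -> : D = \bigcup_k (D `&` [set q | q.2 = k]).
    apply: bigcup_countable => // k _; apply: finite_set_countable.
    apply: contrapT => /(infinite_set_fset (Num.bound (e1 * (2 `^ s) ^+ k))).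
    move=> [B BD]; rewrite leqNgt => /negP; apply.
    rewrite -(ltr_nat R); apply: le_lt_trans (archi_boundP _); last first.
      by rewrite mulr_ge0 ?exprn_ge0 // ltW.
    rewrite -ler_pdivrMr ?exprn_gt0 //.
    apply: le_trans (Dsum (finmap.enum_fset B) _ _); last 2 first.
    - exact: finmap.fset_uniq.
    - by move=> p /BD[].
    rewrite big_seq (eq_bigr (fun=> (2 `^ s) ^- k)); last by move=> p /BD[_ ->].
    by rewrite -big_seq big_const_seq count_predT iter_addr_0 mulr_natl.
  apply/seteqP; split => [q Dq|q [k _ []]//]; by exists q.2.
have /countable_injP[enum enum_inj] := Dcnt.
pose U i := [set x | L x /\ exists2 q, D q & enum q = i /\
  `|q.1 - f x| <= 4 * 2 ^- q.2].
have Uq i q : D q -> enum q = i -> forall x y, U i x -> U i y ->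
    d x y <= 8 * C * 2 ^- q.2.
  move=> Dq qi x y [Lx [q1 Dq1 [q1i q1x]]] [Ly [q2 Dq2 [q2i q2y]]].
  have q1E : q1 = q by apply: enum_inj; rewrite ?inE // q1i.
  have q2E : q2 = q by apply: enum_inj; rewrite ?inE // q2i.
  apply: le_trans (df x y Lx Ly) _; rewrite q1E distrC in q1x; rewrite q2E in q2y.
  rewrite -mulrA mulrCA ler_pM2l //.
  have := ler_distD q.1 (f x) (f y); lra.
have qdelta q : D q -> 8 * C * 2 ^- q.2 <= delta.
  move=> Dq; rewrite mulrC -ler_pdivlMr // leNgt; apply/negP => qd.
  have := Dsum [:: q] isT; rewrite big_seq1 => /(_ ltac:(by move=> p; rewrite inE => /eqP->)).
  rewrite leNgt => /negP; apply; rewrite gt_min -powR_halfX; apply/orP; right.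
  by apply: gt0_ltr_powR => //; rewrite nnegrE ?invr_ge0 ?exprn_ge0 // divr_ge0 // ltW.
have w0 i : (0 <= poweR (diameter d (U i)) s)%E by apply: poweR_ge0.
apply: ge_ereal_inf.
exists (\sum_(i <oo | U i != set0) poweR (diameter d (U i)) s)%E.
  exists U => //; split => [x Lx|i].
    have [q Dq qx] := DL (f x) (ex_intro2 _ _ x Lx erefl).
    by exists (enum q) => //; split => //; exists q.
  apply: diameter_le => x y Ux Uy; have [_ [q Dq [qi _]]] := Ux.
  exact: le_trans (Uq i q Dq qi x y Ux Uy) (qdelta q Dq).
apply: lime_le; first by apply: is_cvg_nneseries => i _ _; exact: w0.
apply: nearW => M; rewrite big_mkord.
have /choice[g gP] : forall i, exists q, U i !=set0 -> D q /\ enum q = i.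
  move=> i; have [[x [_ [q Dq [qi _]]]]|U0] := pselect (U i !=set0).
    by exists q.
  by exists (0, 0%N) => /U0.
apply: le_trans (_ : (\sum_(i < M | U i != set0) (K * (2 `^ s) ^- (g i).2)%:E <= _)%E).
  apply: lee_sum => i /set0P Ui; have [Dg gi] := gP i Ui.
  have Ule : (diameter d (U i) <= (8 * C * 2 ^- (g i).2)%:E)%E.
    by apply: diameter_le => x y; exact: Uq.
  have h0 : 0 <= 8 * C * 2 ^- (g i).2 by rewrite mulr_ge0 ?invr_ge0 ?exprn_ge0 // ltW.
  have d0 : (0 <= diameter d (U i))%E.
    case: Ui => x Ux; apply: le_trans (le_diameter d Ux Ux).
    by rewrite lee_fin.
  apply: le_trans (gt0_ler_poweR (ltW s0) _ _ Ule) _.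
  - by rewrite in_itv /= d0 leey.
  - by rewrite in_itv /= lee_fin h0 leey.
  - by rewrite poweR_EFin powRM ?powR_halfX // ltW.
rewrite sumEFin lee_fin -mulr_sumr mulrC -ler_pdivlMr //.
apply: le_trans (_ : e1 <= _); last by rewrite ge_min lexx.
pose idx := [seq i <- index_iota 0 M | U i != set0].
have idxU i : i \in idx -> U i !=set0.
  by rewrite mem_filter => /andP[/set0P].
rewrite -(big_mkord (fun i => U i != set0) (fun i => (2 `^ s) ^- (g i).2)).
rewrite -big_filter -(big_map g xpredT (fun q => (2 `^ s) ^- q.2)).
apply: Dsum; last by move=> p /mapP[i /idxU Ui ->]; exact: (gP i Ui).1.
rewrite map_inj_in_uniq; first by rewrite filter_uniq // iota_uniq.
move=> i j /idxU Ui /idxU Uj gij.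
by rewrite -(gP i Ui).2 -(gP j Uj).2 gij.
Qed.

End Hausdorff.

(** * Nearby points on two lines *)

Section Euclidean.
Variables (R : realType) (n : nat).
Implicit Types (x y z e v : 'rV[R]_n) (r t : R).

Lemma normr_coord_le x i : `|x 0 i| <= `|x|.
Proof.
rewrite -[leRHS]/(mx_norm x) mx_normrE.
exact: (le_bigmax _ (fun ij : 'I_1 * 'I_n => `|x ij.1 ij.2|) (0, i)).
Qed.

Lemma normr_row_le x r : 0 <= r -> (forall i, `|x 0 i| <= r) -> `|x| <= r.
Proof.
move=> r0 xr; rewrite -[leLHS]/(mx_norm x) mx_normrE.
by apply: bigmax_le => //= -[i j] _ /=; rewrite ord1.
Qed.

Lemma dot_productC x y : dot_product x y = dot_product y x.
Proof. by apply: eq_bigr => i _; rewrite mulrC. Qed.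

Lemma dot_productDl x y z :
  dot_product (x + y) z = dot_product x z + dot_product y z.
Proof. by rewrite -big_split; apply: eq_bigr => i _; rewrite mxE mulrDl. Qed.

Lemma dot_productZl t x y : dot_product (t *: x) y = t * dot_product x y.
Proof. by rewrite mulr_sumr; apply: eq_bigr => i _; rewrite mxE mulrA. Qed.

Lemma dot_productNl x y : dot_product (- x) y = - dot_product x y.
Proof. by rewrite -scaleN1r dot_productZl mulN1r. Qed.

Lemma dot_productDr x y z :
  dot_product z (x + y) = dot_product z x + dot_product z y.
Proof. by rewrite !(dot_productC z) dot_productDl. Qed.

Lemma dot_productZr t x y : dot_product y (t *: x) = t * dot_product y x.
Proof. by rewrite !(dot_productC y) dot_productZl. Qed.

Lemma dot_productNr x y : dot_product y (- x) = - dot_product y x.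
Proof. by rewrite !(dot_productC y) dot_productNl. Qed.

Definition dot_productE := (dot_productDl, dot_productDr, dot_productZl,
  dot_productZr, dot_productNl, dot_productNr).

Lemma dot_product_ge0 x : 0 <= dot_product x x.
Proof. by apply: sumr_ge0 => i _; rewrite -expr2 sqr_ge0. Qed.

Lemma normr_dot_product_le x y : `|dot_product x y| <= n%:R * (`|x| * `|y|).
Proof.
apply: le_trans (ler_norm_sum _ _ _) _.
rewrite -[X in X%:R * _](card_ord n) mulr_natl -sumr_const.
by apply: ler_sum => i _; rewrite normrM ler_pM // normr_coord_le.
Qed.

Lemma eucl_norm_eq1 e : eucl_norm e = 1 -> dot_product e e = 1.
Proof. by move=> e1; rewrite -[LHS]sqr_sqrtr ?dot_product_ge0 // -/(eucl_norm e) e1 expr1n. Qed.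

Lemma normr_le_eucl_norm x : `|x| <= eucl_norm x.
Proof.
apply: normr_row_le => [|i]; first exact: sqrtr_ge0.
rewrite -sqrtr_sqr ler_wsqrtr // /dot_product (bigD1 i) //= -expr2 lerDl.
by apply: sumr_ge0 => j _; rewrite -expr2 sqr_ge0.
Qed.

Lemma eucl_norm_le x : eucl_norm x <= n%:R * `|x|.
Proof.
rewrite -[leRHS]ger0_norm ?mulr_ge0 // -sqrtr_sqr ler_wsqrtr //.
apply: le_trans (ler_norm _) _; apply: le_trans (normr_dot_product_le _ _) _.
rewrite exprMn -expr2 ler_wpM2r ?sqr_ge0 // -natrX ler_nat; nia.
Qed.

Lemma normr_le1 e : eucl_norm e = 1 -> `|e| <= 1.
Proof. by move=> <-; exact: normr_le_eucl_norm. Qed.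

End Euclidean.

Section CloseLines.
Variables (R : realType) (n : nat) (i : 'I_n) (kappa rho : R).
Hypotheses (kappa0 : 0 < kappa) (rho0 : 0 <= rho).

(** The last clause fixes the sign of the direction with a quantitative margin, so that pairs are
    compared in norm without minimizing over signs. *)
Definition oriented_line (l : 'rV[R]_n * 'rV[R]_n) :=
  [/\ eucl_norm l.1 = 1, dot_product l.1 l.2 = 0 & kappa <= l.1 0 i].

(** The sum of the bounds that [close_lines] obtains for the directions and for the offsets. *)
Definition line_const : R :=
  (2 + 2 * n%:R + 2 / kappa) * (1 + 2 * n%:R * rho)
  + 2 * n%:R * rho * (1 + n%:R).

(* Writing [a] and [a'] for the parameter increments along the two lines,
   [a e] and [a' e'] are close. As [e] and [e'] are unit vectors, so are [|a|] and [|a'|],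
   and the orientation makes [a] and [a'] close. *)
Lemma close_lines (l l' : 'rV[R]_n * 'rV[R]_n) (D t1 t2 t1' t2' : R)
    (p1 p2 p1' p2' : 'rV[R]_n) :
  oriented_line l -> oriented_line l' ->
  p1 = t1 *: l.1 + l.2 -> p2 = t2 *: l.1 + l.2 ->
  p1' = t1' *: l'.1 + l'.2 -> p2' = t2' *: l'.1 + l'.2 ->
  `|p1| <= rho -> `|p1'| <= rho -> `|p2'| <= rho ->
  `|p1 - p1'| <= D -> `|p2 - p2'| <= D ->
  `|l - l'| * `|p1' - p2'| <= line_const * D.
Proof.
case: l l' => [e v] [e' v'] [/= e1 ev ei] [/= e'1 e'v' e'i].
move=> p1E p2E p1'E p2'E p1r p1'r p2'r d1 d2.
have ee := eucl_norm_eq1 e1; have e'e' := eucl_norm_eq1 e'1.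
have en := normr_le1 e1; have e'n := normr_le1 e'1.
have D0 : 0 <= D by apply: le_trans d1.
pose N : R := n%:R; have N0 : 0 <= N by [].
have dot_le (x y : 'rV[R]_n) r r' : `|x| <= r -> `|y| <= r' ->
    `|dot_product x y| <= N * (r * r').
  move=> xr yr; apply: le_trans (normr_dot_product_le x y) _.
  by apply: ler_wpM2l => //; exact: ler_pM.
pose a := t1 - t2; pose a' := t1' - t2'.
pose X := a *: e - a' *: e'.
have XE : X = (p1 - p1') - (p2 - p2').
  by apply/rowP => j; rewrite /X p1E p2E p1'E p2'E /a /a' !mxE; ring.
have X2 : `|X| <= 2 * D by rewrite XE; apply: le_trans (ler_normB _ _) _; lra.
(* As [e] and [e'] are unit vectors, the product of [X] with [a *: e + a' *: e'] is a difference of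
   squares; dividing by [|a| + |a'|] leaves the difference of absolute values. *)
have absD : `| `|a| - `|a'| | <= 2 * N * D.
  have := normr_dot_product_le X (a *: e + a' *: e').
  have -> : dot_product X (a *: e + a' *: e') = (`|a| - `|a'|) * (`|a| + `|a'|).
    rewrite -subr_sqr !real_normK ?num_real // /X !dot_productE ee e'e'.
    by rewrite (dot_productC e' e); ring.
  rewrite normrM [X in _ * X <= _]ger0_norm ?addr_ge0 // -/N.
  have : `|a *: e + a' *: e'| <= `|a| + `|a'|.
    apply: le_trans (ler_normD _ _) _; rewrite !normrZ.
    by apply: lerD; rewrite ler_piMr.
  have [s0|s0] := eqVneq (`|a| + `|a'|) 0.
    have a0 : `|a| = 0 by apply: le_anti; rewrite normr_ge0 andbT; have := normr_ge0 a'; lra.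
    have a'0 : `|a'| = 0 by apply: le_anti; rewrite normr_ge0 andbT; have := normr_ge0 a; lra.
    by move=> _ _; rewrite a0 a'0 subr0 normr0 !mulr_ge0.
  have {}s0 : 0 < `|a| + `|a'| by rewrite lt_def s0 addr_ge0.
  move=> h1 h2; rewrite -(ler_pM2r s0); apply: le_trans h2 _.
  rewrite [leRHS](_ : _ = N * (2 * D * (`|a| + `|a'|))); last by ring.
  by rewrite ler_wpM2l // ler_pM.
pose K := 2 * N + 2 / kappa.
have K0 : 0 <= 2 / kappa by rewrite divr_ge0 // ltW.
have aa' : `|a - a'| <= K * D.
  (* For equal signs [absD] applies. For opposite signs the two terms of coordinate [i] of [X]
     reinforce each other, and orientation bounds it below by [kappa * |a - a'|]. *)
  have Xi : kappa * `|a - a'| <= 2 * D \/ `|a - a'| <= 2 * N * D.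
    have := le_trans (normr_coord_le X i) X2; rewrite !mxE.
    have [a0|a0] := leP 0 a; have [a'0|a'0] := leP 0 a'.
    - by right; move: absD; rewrite (ger0_norm a0) (ger0_norm a'0).
    - left; rewrite ger0_norm; last lra.
      have h1 : kappa * a <= a * e 0 i by rewrite mulrC ler_wpM2l.
      have h2 : kappa * - a' <= - a' * e' 0 i by rewrite mulrC ler_wpM2l //; lra.
      have := ler_norm (a * e 0 i - a' * e' 0 i); lra.
    - left; rewrite ler0_norm; last lra.
      have h1 : kappa * - a <= - a * e 0 i by rewrite mulrC ler_wpM2l //; lra.
      have h2 : kappa * a' <= a' * e' 0 i by rewrite mulrC ler_wpM2l.
      have := ler_norm (- (a * e 0 i - a' * e' 0 i)); rewrite normrN; lra.
    - right; move: absD; rewrite (ltr0_norm a0) (ltr0_norm a'0).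
      by rewrite -normrN opprD !opprK.
  case: Xi => Xi; last by rewrite /K; nra.
  have : `|a - a'| <= 2 / kappa * D.
    by rewrite mulrAC ler_pdivlMr // mulrC.
  rewrite /K; nra.
have a'e : `|a'| * `|e - e'| <= (2 + K) * D.
  rewrite -normrZ.
  have -> : a' *: (e - e') = X - (a - a') *: e.
    by apply/rowP => j; rewrite !mxE; ring.
  apply: le_trans (ler_normB _ _) _; rewrite normrZ.
  have : `|a - a'| * `|e| <= K * D by rewrite -[leRHS]mulr1 ler_pM.
  lra.
have t1E : t1 = dot_product p1 e.
  by rewrite p1E !dot_productE ee dot_productC ev; ring.
have tE (w u : 'rV[R]_n) t : eucl_norm w = 1 -> dot_product w u = 0 ->
    `|t *: w + u| <= rho -> `|t| <= N * rho.
  move=> w1 wu tr.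
  have -> : t = dot_product (t *: w + u) w.
    by rewrite !dot_productE (eucl_norm_eq1 w1) dot_productC wu; ring.
  by rewrite -[rho]mulr1; apply: dot_le => //; exact: normr_le1.
have t1r : `|t1| <= N * rho by apply: (tE e v) => //; rewrite -p1E.
have a'r : `|a'| <= 2 * N * rho.
  have : `|t1'| <= N * rho by apply: (tE e' v') => //; rewrite -p1'E.
  have : `|t2'| <= N * rho by apply: (tE e' v') => //; rewrite -p2'E.
  have := ler_normB t1' t2'; rewrite /a'; lra.
have t1t1' : `|t1 - t1'| <= N * D + N * rho * `|e - e'|.
  have -> : t1 - t1' = dot_product (p1 - p1') e + dot_product p1' (e - e').
    rewrite p1E p1'E !dot_productE ee e'e' (dot_productC v e) ev (dot_productC v' e') e'v'.
    by ring.
  apply: le_trans (ler_normD _ _) _; apply: lerD.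
    by rewrite -[D]mulr1; exact: dot_le.
  by rewrite -mulrA; exact: dot_le.
have vv' : `|v - v'| <= (1 + N) * D + 2 * N * rho * `|e - e'|.
  have -> : v - v' = (p1 - p1') - (t1 *: (e - e') + (t1 - t1') *: e').
    by apply/rowP => j; rewrite p1E p1'E !mxE; ring.
  apply: le_trans (ler_normB _ _) _.
  have := ler_normD (t1 *: (e - e')) ((t1 - t1') *: e'); rewrite !normrZ.
  have : `|t1| * `|e - e'| <= N * rho * `|e - e'| by rewrite ler_wpM2r.
  have : `|t1 - t1'| * `|e'| <= `|t1 - t1'| by rewrite ler_piMr.
  lra.
(* In the term of [vv'] with [D], the factor [|a'|] is at most [2 * N * rho]; in the other term it
   joins [|e - e'|], and [a'e] applies. *)
have a'v : `|a'| * `|v - v'| <= 2 * N * rho * (1 + N) * D + 2 * N * rho * ((2 + K) * D).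
  have h1 : `|a'| * `|v - v'| <= `|a'| * ((1 + N) * D + 2 * N * rho * `|e - e'|).
    by rewrite ler_wpM2l.
  have h2 : `|a'| * ((1 + N) * D) <= 2 * N * rho * ((1 + N) * D).
    by rewrite ler_wpM2r // mulr_ge0 // addr_ge0.
  have h3 : 2 * N * rho * (`|a'| * `|e - e'|) <= 2 * N * rho * ((2 + K) * D).
    by rewrite ler_wpM2l // !mulr_ge0.
  lra.
have p'a : `|p1' - p2'| <= `|a'|.
  have -> : p1' - p2' = a' *: e' by apply/rowP => j; rewrite p1'E p2'E !mxE /a'; ring.
  by rewrite normrZ ler_piMr.
apply: le_trans (_ : `|(e - e', v - v')| * `|a'| <= _); first by rewrite ler_wpM2l.
have KD : 0 <= (2 + K) * D by rewrite mulr_ge0 // /K !addr_ge0 // mulr_ge0.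
have NrD : 0 <= 2 * N * rho * ((2 + K) * D) by rewrite (mulr_ge0 _ KD) // !mulr_ge0.
have NrD' : 0 <= 2 * N * rho * (1 + N) * D by rewrite !mulr_ge0 // addr_ge0.
have -> : line_const * D = (2 + K) * D + 2 * N * rho * ((2 + K) * D)
   + 2 * N * rho * (1 + N) * D by rewrite /line_const /K /N; ring.
rewrite mulrC prod_normE /= maxr_pMr // ge_max.
apply/andP; split; lra.
Qed.

End CloseLines.

(** * Incidences at a fixed scale *)

Lemma sub_in_count (T : eqType) (a b : pred T) (s : seq T) :
  (forall x, x \in s -> a x -> b x) -> (count a s <= count b s)%N.
Proof.
elim: s => //= x s IH ab; apply: leq_add.
  by case: (boolP (a x)) => // /ab -> //; rewrite mem_head.
by apply: IH => y ys; apply: ab; rewrite inE ys orbT.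
Qed.

Section Counting.
Variable R : realType.

Lemma sqr_sum_le (T : Type) (f : T -> R) (Y : seq T) :
  (\sum_(y <- Y) f y) ^+ 2 <= (size Y)%:R * \sum_(y <- Y) f y ^+ 2.
Proof.
elim: Y => [|y Y IH]; first by rewrite !big_nil expr0n mulr0.
rewrite !big_cons /= -natr1.
have Q0 : 0 <= \sum_(z <- Y) f z ^+ 2 by apply: sumr_ge0 => z _; exact: sqr_ge0.
move: (size Y)%:R (ler0n R (size Y)) IH => m m0.
move: (\sum_(z <- Y) f z ^+ 2) Q0 (\sum_(z <- Y) f z) (f y) => Q Q0 S x IH.
suff : 2 * x * S <= m * x ^+ 2 + Q by nra.
have [m00|m00] := eqVneq m 0.
  have -> : S = 0 by apply/eqP; rewrite -sqrf_eq0 eq_le sqr_ge0 andbT; nra.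
  by rewrite mulr0 addr_ge0 // mulr_ge0 // sqr_ge0.
have {}m0 : 0 < m by rewrite lt_def m00.
rewrite -(ler_pM2l m0).
have := sqr_ge0 (m * x - S); nra.
Qed.

Lemma sum_by_fiber (S T : eqType) (phi : S -> T) (P : seq S) (Y : seq T)
    (f : T -> R) : uniq Y -> (forall p, p \in P -> phi p \in Y) ->
  \sum_(p <- P) f (phi p)
  = \sum_(y <- Y) (count (fun p => phi p == y) P)%:R * f y.
Proof.
move=> uY PY; transitivity (\sum_(p <- P) \sum_(y <- Y | y == phi p) f y).
  rewrite big_seq [RHS]big_seq; apply: eq_bigr => p pP.
  by rewrite -big_filter filter_pred1_uniq ?PY // big_seq1.
under eq_bigr do rewrite big_mkcond.
rewrite exchange_big /=; apply: eq_bigr => y _.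
rewrite -big_mkcond /= -sum1_count natr_sum mulr_suml.
by apply: eq_big => [p|p _]; rewrite ?mul1r // eq_sym.
Qed.

(* [P] is a discrete analogue, at scale [2^-k], of an [s]-dimensional Frostman
   measure, with [b = 2 `^ s]. *)
Definition frostman_seq (V : normedModType R) (b : R) (k : nat) (P : seq V) :=
  (size P)%:R <= b ^+ k /\ forall x j, (j <= k)%N ->
    (count (fun p => `|x - p| <= 2 ^- j) P)%:R <= b ^+ (k - j).

Variables (n : nat) (i : 'I_n) (kappa rho : R).
Hypotheses (kappa0 : 0 < kappa) (rho0 : 0 <= rho).
Local Notation V := 'rV[R]_n.
Local Notation oriented := (oriented_line i kappa).

Definition bounded_line (l : V * V) : set V :=
  [set p | (exists t, p = t *: l.1 + l.2) /\ `|p| <= rho].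

(** With [phi] sending a point to the centre of a nearby ball, this counts the pairs of points that
    use the same ball. *)
Definition incidences (phi : V -> V) (P P' : seq V) : R :=
  \sum_(p' <- P') (count (fun p => phi p == phi p') P)%:R.

(** By [close_lines], the points of [P'] sharing a ball with [P] lie within
    [2 ^+ B * 2 ^- k * 2 ^+ j] of any one of them: at most [a ^+ (j + B)] points. Each is matched
    only with points of [P] at distance at most [8 * 2 ^- k]: at most [a ^+ 3]. If [k <= j + B], the
    bound on the size of [P'] replaces the first count. *)
Lemma incidences_le (phi : V -> V) (l l' : V * V) (P P' : seq V) (a : R)
    (k j B : nat) : 1 <= a -> (3 <= k)%N -> (j <= k)%N ->
  8 * line_const n kappa rho <= 2 ^+ B ->
  oriented l -> oriented l' ->
  (forall p, p \in P -> bounded_line l p) ->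
  (forall p, p \in P' -> bounded_line l' p) ->
  (forall p, p \in P -> `|phi p - p| <= 4 * 2 ^- k) ->
  (forall p, p \in P' -> `|phi p - p| <= 4 * 2 ^- k) ->
  frostman_seq a k P -> frostman_seq a k P' ->
  2 ^- j < `|l - l'| \/ j = k ->
  incidences phi P P' <= a ^+ (j + B + 3).
Proof.
move=> a1 k3 jk CB ol ol' Pl Pl' Pphi P'phi [_ FP] [szP' FP'] lj.
have a0 : 0 <= a by apply: le_trans a1.
have h0 m : 0 < (2 : R) ^- m by rewrite invr_gt0 exprn_gt0.
have close p p' : p \in P -> p' \in P' -> phi p == phi p' ->
    `|p - p'| <= 8 * 2 ^- k.
  move=> pP p'P' /eqP pp'.
  have := ler_distD (phi p) p p'; rewrite (distrC p (phi p)).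
  have := Pphi p pP; have := P'phi p' p'P'; rewrite -pp'; lra.
pose near p' := has (fun p => phi p == phi p') P.
have fib p' : p' \in P' ->
    (count (fun p => phi p == phi p') P)%:R <= (near p')%:R * a ^+ 3.
  move=> p'P'; rewrite /near has_count; case: ltnP => [_|]; last first.
    by rewrite leqn0 => /eqP ->; rewrite mul0r.
  rewrite mul1r; have := FP p' (k - 3)%N (leq_subr _ _); rewrite subKn //.
  apply: le_trans; rewrite ler_nat; apply: sub_in_count => p pP pp'.
  rewrite distrC; apply: le_trans (close p p' pP p'P' pp') _.
  have -> : (2 : R) ^- (k - 3) = 2 ^- k * 2 ^+ 3.
    by rewrite -[in RHS](subnK k3) exprD invfM -mulrA mulVf ?mulr1 // expf_neq0.
  by rewrite mulrC ler_pM2l //; lra.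
have cnt : (count near P')%:R <= a ^+ (j + B).
  have [/hasP[p0 p0P' p0near]|] := boolP (has near P'); last first.
    by rewrite has_count -leqNgt leqn0 => /eqP ->; rewrite exprn_ge0.
  have [kjB|kjB] := leqP k (j + B).
    apply: le_trans (_ : (size P')%:R <= _); first by rewrite ler_nat count_size.
    by apply: le_trans szP' _; rewrite ler_weXn2l.
  case: lj => [lj|jk']; last by rewrite jk' ltnNge leq_addr in kjB.
  have := FP' p0 (k - (j + B))%N (leq_subr _ _); rewrite subKn; last exact: ltnW.
  apply: le_trans; rewrite ler_nat; apply: sub_in_count => p pP' pnear.
  have [q0 q0P q0p0] := hasP p0near; have [q qP qp] := hasP pnear.
  have [[t0 t0E] q0r] := Pl q0 q0P; have [[t tE] qr] := Pl q qP.
  have [[t0' t0'E] p0r] := Pl' p0 p0P'; have [[t' t'E] pr] := Pl' p pP'.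
  have := close_lines kappa0 rho0 ol ol' t0E tE t0'E t'E q0r p0r pr
    (close _ _ q0P p0P' q0p0) (close _ _ qP pP' qp).
  have -> : (2 : R) ^- (k - (j + B)) = 2 ^+ B * 2 ^- k * 2 ^+ j.
    rewrite -[in RHS](subnK (ltnW kjB)) !exprD !invfM.
    have := expf_neq0 j (_ : (2 : R) != 0); have := expf_neq0 B (_ : (2 : R) != 0).
    have := expf_neq0 (k - (j + B)) (_ : (2 : R) != 0).
    move: (2 ^+ (k - (j + B))) (2 ^+ j) (2 ^+ B) => x y z hx hy hz.
    by field; rewrite hx ?hy ?hz.
  move=> h; rewrite -ler_pdivrMr ?exprn_gt0 //.
  have := h0 k; have := h0 j; have := normr_ge0 (p0 - p).
  move: h lj CB; move: `|p0 - p| `|l - l'| => x y.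
  move: (2 ^- k) (2 ^- j) (2 ^+ B) (line_const n kappa rho) => dk dj b C.
  move=> h lj CB x0 dj0 dk0.
  nra.
rewrite /incidences big_seq; apply: le_trans (ler_sum _ fib) _.
rewrite -big_seq -mulr_suml exprD ler_wpM2r ?exprn_ge0 //.
suff -> : \sum_(p' <- P') (near p')%:R = (count near P')%:R :> R by [].
rewrite -sum1_count natr_sum [RHS]big_mkcond; apply: eq_bigr => p _.
by case: (near p).
Qed.

(** At most [g ^+ (k - j) <= a ^+ (k - j)] lines lie within [2 ^- j] of [l], and a line at about
    that distance contributes [a ^+ j] up to a constant. Each scale thus adds about [a ^+ k], and
    the number of scales gives [k.+2]. *)
Lemma sum_incidences_le (phi : V -> V) (L : seq (V * V)) (P : V * V -> seq V)
    (a g : R) (k B : nat) : 1 <= g -> g <= a -> (3 <= k)%N ->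
  8 * line_const n kappa rho <= 2 ^+ B ->
  (forall l, l \in L -> [/\ oriented l, frostman_seq a k (P l) &
     forall p, p \in P l -> bounded_line l p /\ `|phi p - p| <= 4 * 2 ^- k]) ->
  frostman_seq g k L ->
  forall l, l \in L -> \sum_(l' <- L) incidences phi (P l) (P l')
    <= a ^+ (B + 4) * k.+2%:R * a ^+ k.
Proof.
move=> g1 ga k3 CB LP [szL FL] l lL.
have a1 : 1 <= a by apply: le_trans ga.
have a0 : 0 <= a by apply: le_trans a1.
have [ol Fl Pl] := LP l lL.
(* For the least [j] with [2 ^- j < |l - l'|], the lines are still within [2 ^- (j - 1)], so it is
   the term of index [j - 1] that must carry [a ^+ j]; hence the exponent [j.+1]. The summand 1
   serves [j = 0]. *)
have one l' : l' \in L -> incidences phi (P l) (P l') <=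
    a ^+ (B + 3) * (1 + \sum_(j < k.+1) (`|l - l'| <= 2 ^- j)%R%:R * a ^+ j.+1).
  move=> l'L; have [ol' Fl' Pl'] := LP l' l'L.
  have bound j : (j <= k)%N -> 2 ^- j < `|l - l'| \/ j = k ->
      incidences phi (P l) (P l') <= a ^+ (B + 3) * a ^+ j.
    move=> jk lj; rewrite -exprD addnC addnA.
    apply: (@incidences_le phi l l' _ _ a k j B) => // p.
    - by move=> /Pl[].
    - by move=> /Pl'[].
    - by move=> /Pl[].
    - by move=> /Pl'[].
  have sum0 (A : pred 'I_k.+1) : 0 <= \sum_(j < k.+1 | A j)
      (`|l - l'| <= 2 ^- j)%R%:R * a ^+ j.+1.
    by apply: sumr_ge0 => j _; rewrite mulr_ge0 ?exprn_ge0.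
  have term (j : 'I_k.+1) : `|l - l'| <= 2 ^- j -> a ^+ j.+1 <=
      \sum_(j < k.+1) (`|l - l'| <= 2 ^- j)%R%:R * a ^+ j.+1.
    by move=> jl; rewrite (bigD1 j) //= jl mul1r lerDl sum0.
  have aB : 0 <= a ^+ (B + 3) by rewrite exprn_ge0.
  have [lk|lk] := leP `|l - l'| (2 ^- k).
    apply: le_trans (bound k (leqnn k) (or_intror erefl)) _.
    rewrite ler_wpM2l //; apply: le_trans (_ : a ^+ k.+1 <= _).
      by rewrite ler_weXn2l.
    by have := term ord_max lk; move=> /= /le_trans -> //; rewrite lerDr.
  have exj : exists j, (2 : R) ^- j < `|l - l'| by exists k.
  case: (ex_minnP exj) => j lj jmin.
  have jk : (j <= k)%N by apply: jmin.
  apply: le_trans (bound j jk (or_introl lj)) _; rewrite ler_wpM2l //.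
  case: j lj jmin jk => [|j] lj jmin jk.
    by rewrite expr0 lerDl sum0.
  have jk' : (j < k.+1)%N by rewrite ltnS ltnW.
  have := term (Ordinal jk'); rewrite /= => termj.
  have : a ^+ j.+1 <= \sum_(j0 < k.+1) (`|l - l'| <= 2 ^- j0)%R%:R * a ^+ j0.+1.
    by apply: termj; rewrite leNgt; apply/negP => /jmin; rewrite ltnn.
  by move=> /le_trans -> //; rewrite lerDr.
rewrite big_seq; apply: le_trans (ler_sum _ one) _; rewrite -big_seq.
rewrite -mulr_sumr.
have -> : a ^+ (B + 4) * k.+2%:R * a ^+ k = a ^+ (B + 3) * (k.+2%:R * a ^+ k.+1).
  by rewrite addnS !exprS; ring.
rewrite ler_wpM2l ?exprn_ge0 // big_split /= exchange_big /=.
have gak m : g ^+ m <= a ^+ m.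
  by rewrite lerXn2r // nnegrE // (le_trans _ g1).
have sz : \sum_(l' <- L) (1 : R) <= a ^+ k.+1.
  have -> : \sum_(l' <- L) (1 : R) = (size L)%:R by rewrite -sum1_size natr_sum.
  apply: le_trans szL _; apply: le_trans (gak k) _.
  by rewrite ler_weXn2l.
have -> : k.+2%:R * a ^+ k.+1 = a ^+ k.+1 + \sum_(j < k.+1) a ^+ k.+1.
  by rewrite sumr_const card_ord -mulrS mulr_natl.
rewrite lerD //.
apply: ler_sum => j _; rewrite -mulr_suml.
have -> : \sum_(l' <- L) ((`|l - l'| <= 2 ^- j)%R%:R : R)
    = (count (fun l' => `|l - l'| <= 2 ^- j) L)%:R.
  rewrite -sum1_count natr_sum [RHS]big_mkcond; apply: eq_bigr => l' _.
  by case: (`|l - l'| <= 2 ^- j).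
have jk : (j <= k)%N by rewrite -ltnS.
have -> : a ^+ k.+1 = a ^+ (k - j) * a ^+ j.+1.
  by rewrite -exprD addnS subnK.
rewrite ler_wpM2r ?exprn_ge0 //; apply: le_trans (FL l j jk) _.
exact: gak.
Qed.

(* Cauchy-Schwarz over the sites [Y], together with the pairwise bounds. *)
Lemma sqr_sum_size_le (phi : V -> V) (L : seq (V * V)) (P : V * V -> seq V)
    (Y : seq V) (a g : R) (k B : nat) : 1 <= g -> g <= a -> (3 <= k)%N ->
  8 * line_const n kappa rho <= 2 ^+ B ->
  (forall l, l \in L -> [/\ oriented l, frostman_seq a k (P l) &
     forall p, p \in P l -> bounded_line l p /\ `|phi p - p| <= 4 * 2 ^- k]) ->
  frostman_seq g k L -> uniq Y ->
  (forall l p, l \in L -> p \in P l -> phi p \in Y) ->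
  (\sum_(l <- L) (size (P l))%:R) ^+ 2 <=
    (size Y)%:R * ((size L)%:R * (a ^+ (B + 4) * k.+2%:R * a ^+ k)).
Proof.
move=> g1 ga k3 CB LP FL uY PY.
pose c l y : R := (count (fun p => phi p == y) (P l))%:R.
have sizeE l : l \in L -> (size (P l))%:R = \sum_(y <- Y) c l y.
  move=> lL; rewrite -sum1_size natr_sum.
  apply: etrans (sum_by_fiber (fun=> 1) uY (fun p => PY l p lL)) _.
  by apply: eq_bigr => y _; rewrite mulr1.
have -> : \sum_(l <- L) (size (P l))%:R = \sum_(y <- Y) \sum_(l <- L) c l y.
  rewrite exchange_big /= big_seq [RHS]big_seq.
  by apply: eq_bigr => l lL; exact: sizeE.
apply: le_trans (sqr_sum_le _ _) _; rewrite ler_wpM2l //.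
(* Expanding the squares, pairs of points in one fibre of [phi] are regrouped by their two lines. *)
have -> : \sum_(y <- Y) (\sum_(l <- L) c l y) ^+ 2
    = \sum_(l <- L) \sum_(l' <- L) incidences phi (P l) (P l').
  under eq_bigr do rewrite expr2 mulr_suml.
  rewrite exchange_big /=; apply: eq_bigr => l _.
  under eq_bigr do rewrite mulr_sumr.
  rewrite exchange_big /= big_seq [RHS]big_seq; apply: eq_bigr => l' l'L.
  rewrite /incidences (sum_by_fiber (c l) uY); last by move=> p; exact: PY.
  by apply: eq_bigr => y _; rewrite mulrC.
have -> : (size L)%:R * (a ^+ (B + 4) * k.+2%:R * a ^+ k)
    = \sum_(l <- L) (a ^+ (B + 4) * k.+2%:R * a ^+ k).
  by rewrite big_const_seq count_predT iter_addr_0 mulr_natl.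
rewrite big_seq [leRHS]big_seq; apply: ler_sum => l lL.
exact: (sum_incidences_le g1 ga k3 CB LP FL lL).
Qed.

End Counting.

(** * Choice of the scale *)

Section Scales.
Variable R : realType.
Implicit Types tau C c : R.

(** Bernoulli's inequality at [k./2], squared, gives quadratic growth in [k], which beats the linear
    left side. *)
Lemma geometric_growth tau C c : 1 < tau -> 0 < c ->
  exists k0, forall k, (k0 <= k)%N -> C * k.+2%:R < c * tau ^+ k.
Proof.
move=> tau1 c0; pose h := tau - 1.
have h0 : 0 < h by rewrite subr_gt0.
have tau0 : 0 < tau by rewrite (lt_trans _ tau1).
have bern m : 1 + m%:R * h <= tau ^+ m.
  elim: m => [|m IH]; first by rewrite mul0r addr0 expr0.
  have -> : tau ^+ m.+1 = (1 + h) * tau ^+ m by rewrite exprS /h; ring.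
  rewrite -natr1.
  have := ler0n R m; move: (tau ^+ m) (m%:R : R) IH h0 => t r.
  by move: h => h; nra.
have ch : 0 < c * h ^+ 2 by rewrite mulr_gt0 // exprn_gt0.
pose D := 5 * `|C| / (c * h ^+ 2).
have D0 : 0 <= D by rewrite divr_ge0 ?mulr_ge0 // ltW.
pose m0 := Num.bound D.
exists (m0.+1.*2) => k; rewrite -leq_double -[k]odd_double_half => hk.
set m := k./2 in hk *.
have mm0 : (m0 < m)%N by move: hk; lia.
have Dm : D < m%:R.
  by apply: lt_le_trans (archi_boundP D0) _; rewrite ler_nat ltnW.
have m1 : 1 <= m%:R :> R by rewrite ler1n; lia.
have {}Dm : 5 * `|C| < m%:R * (c * h ^+ 2) by rewrite -ltr_pdivrMr.
(* From [k <= 2 * m + 1] and [1 <= m] one gets [k + 2 <= 5 * m]. *)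
apply: le_lt_trans (_ : `|C| * (5 * m%:R) < _).
  apply: le_trans (ler_norm _) _; rewrite normrM ler_wpM2l // ger0_norm //.
  by rewrite -natrM ler_nat; case: (odd k); lia.
apply: lt_le_trans (_ : c * (m%:R * h) ^+ 2 <= _).
  by rewrite exprMn; nra.
rewrite ler_wpM2l ?(ltW c0) //; apply: le_trans (_ : tau ^+ m * tau ^+ m <= _).
  rewrite expr2 ler_pM ?mulr_ge0 ?(ltW h0) //.
    by apply: le_trans (bern m); rewrite lerDr.
  by apply: le_trans (bern m); rewrite lerDr.
by rewrite -exprD addnn ler_weXn2l ?leq_addl // ltW.
Qed.

(** The tail of the geometric series is at most [tau ^- k0 / (1 - tau^-1)], and a second use of
    [geometric_growth] makes [tau ^- k0 <= 1 - tau^-1]. *)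
Lemma exists_scale tau C c : 1 < tau -> 0 < c ->
  exists k0, [/\ (3 <= k0)%N,
    forall k, (k0 <= k)%N -> C * k.+2%:R < c * tau ^+ k &
    forall M, \sum_(k < M | (k0 <= k)%N) tau ^- k <= 1].
Proof.
move=> tau1 c0; have tau0 : 0 < tau by rewrite (lt_trans _ tau1).
have [k1 H1] := geometric_growth C tau1 c0.
have x1 : 0 < 1 - tau^-1 by rewrite subr_gt0 invf_lt1.
have [k2 H2] := geometric_growth 1 tau1 x1.
exists (k1 + k2 + 3)%N; split => [||M]; first by lia.
  by move=> k hk; apply: H1; lia.
set k0 := (k1 + k2 + 3)%N.
have tele : (1 - tau^-1) * (\sum_(k < M | (k0 <= k)%N) tau ^- k) +
    (if (k0 <= M)%N then tau ^- M else tau ^- k0) = tau ^- k0.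
  elim: M => [|M IH]; first by rewrite big_ord0 mulr0 add0r /k0 addnS.
  rewrite big_mkcond big_ord_recr -big_mkcond /= mulrDr -[in RHS]IH.
  case: (leqP k0 M) => hM.
    rewrite (leq_trans hM) // exprS invfM; ring.
  case: (leqP k0 M.+1) => hM'; last by ring.
  by rewrite (_ : M.+1 = k0) ?mulr0 ?addr0 //; apply/eqP; rewrite eqn_leq hM hM'.
rewrite -(ler_pM2l x1) mulr1; apply: le_trans (_ : tau ^- k0 <= _).
  have : 0 <= if (k0 <= M)%N then tau ^- M else tau ^- k0.
    by case: ifP => _; rewrite invr_ge0 exprn_ge0 // ltW.
  by move: tele; lra.
have := H2 k0 ltac:(rewrite /k0; lia).
rewrite mul1r => /ltW h; rewrite -[leLHS]mul1r ler_pdivrMr ?exprn_gt0 //.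
by apply: le_trans h; rewrite ler1n.
Qed.

(** Countable subadditivity read backwards, with the share [tau ^- k] of [c] given to level [k]. The
    loss is exponential in [k], but its base [tau] may be as close to 1 as desired. *)
Lemma small_pigeonhole (V : normedModType R) tau (b c : R) k0
    (A : set V) (Ak : nat -> set V) : 0 < b -> 0 <= c ->
  (forall M, \sum_(k < M | (k0 <= k)%N) tau ^- k <= 1) ->
  (forall x, A x -> exists2 k, (k0 <= k)%N & Ak k x) ->
  ~ small b c A -> exists2 k, (k0 <= k)%N & ~ small b (c * tau ^- k) (Ak k).
Proof.
move=> b0 c0 sum1 AAk nsA; apply: contrapT => noex; apply: nsA.
apply: (@small_sub _ _ _ _ _ (\bigcup_k [set x | (k0 <= k)%N /\ Ak k x])).
  by move=> x /AAk[k hk Akx]; exists k.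
apply: (@small_bigcup _ _ _ (fun k => if (k0 <= k)%N then c * tau ^- k else 0)) => //.
  move=> k; case: leqP => hk.
    apply: (@small_sub _ _ _ _ _ (Ak k)) => [x []//|].
    by apply: contrapT => ns; apply: noex; exists k.
  exists set0 => [x [] //|[|p F] _ FD]; first by rewrite big_nil.
  by case: (FD p (mem_head _ _)).
move=> M; rewrite -big_mkcond -mulr_sumr -[leRHS]mulr1.
by rewrite ler_wpM2l.
Qed.

End Scales.

(** * Double counting for lines with uniform constants *)

Section Furstenberg.
Variables (R : realType) (n : nat) (i : 'I_n) (kappa rho : R).
Hypotheses (kappa0 : 0 < kappa) (rho0 : 0 <= rho).
Local Notation V := 'rV[R]_n.

(** Of the four powers of [tau], one pays for pigeonholing the lines and two for pigeonholing the
    points, whose number enters squared; the last outgrows the factor [a ^+ (B + 4) * k.+2%:R] of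
    the incidence bound. *)
Lemma small_lines (a g sigma tau c0 c1 : R) (E : set V) (Lam : set (V * V)) :
  1 <= g -> g <= a -> 1 <= sigma -> 1 < tau -> sigma * tau ^+ 4 <= a * g ->
  0 < c0 -> c0 <= 1 -> 0 < c1 -> c1 <= 1 ->
  (forall e, 0 < e -> small sigma e E) ->
  (forall l, Lam l -> oriented_line i kappa l /\
     ~ small a c0 (E `&` bounded_line rho l)) ->
  small g c1 Lam.
Proof.
move=> g1 ga sig1 tau1 sigag c00 c01 c10 c11 sE LamP; apply: contrapT => nsLam.
have a1 : 1 <= a by apply: le_trans ga.
have a0 : 0 < a by apply: lt_le_trans a1.
have g0 : 0 < g by apply: lt_le_trans g1.
have sig0 : 0 < sigma by apply: lt_le_trans sig1.
have tau0 : 0 < tau by apply: lt_trans tau1.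
have [B CB] : exists B, 8 * line_const n kappa rho <= 2 ^+ B.
  pose x := `|8 * line_const n kappa rho|; exists (Num.bound x).
  apply: le_trans (ler_norm _) _; apply: ltW.
  apply: lt_le_trans (archi_boundP (normr_ge0 _)) _.
  by rewrite -natrX ler_nat ltnW // ltn_expl.
have c8 : 0 < c0 ^+ 2 * c1 / 8 by rewrite divr_gt0 // mulr_gt0 // exprn_gt0.
have [k0 [k03 growth sum1]] := exists_scale (a ^+ (B + 4)) tau1 c8.
have tauk k : 0 < tau ^- k by rewrite invr_gt0 exprn_gt0.
have tauk1 k : tau ^- k <= 1 by rewrite invf_le1 ?exprn_gt0 // exprn_ege1 // ltW.
(* With this total weight no ball of level below [k0] can occur, and at most [sigma ^+ k] balls have
   level [k]. *)
have e0 : 0 < sigma ^- k0 / 2 by rewrite divr_gt0 // invr_gt0 exprn_gt0.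
have [D DE Dsum] := sE _ e0.
have Dk0 p : D p -> (k0 <= p.2)%N.
  move=> Dp; rewrite leqNgt; apply/negP => pk0.
  have := Dsum [:: p] isT; rewrite big_seq1.
  move=> /(_ ltac:(by move=> q; rewrite inE => /eqP->)).
  have : sigma ^- k0 <= sigma ^- p.2.
    by rewrite lef_pV2 ?posrE ?exprn_gt0 // ler_weXn2l // ltnW.
  by move: e0; lra.
pose Ek k := [set x | exists2 y, D (y, k) & `|y - x| <= 4 * 2 ^- k].
pose F l := E `&` bounded_line rho l.
have lineP l : Lam l -> exists2 k, (k0 <= k)%N &
    ~ small a (c0 * tau ^- k) (Ek k `&` F l).
  move=> Ll; apply: (small_pigeonhole a0 (ltW c00) sum1 _ (LamP l Ll).2).
  move=> x [Ex xl]; have [[y k] Dyk yx] := DE x Ex.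
  by exists k; [exact: Dk0 Dyk|split => //; exists y].
(* The first pigeonholing gave each line its own level; the second finds one level shared by a large
   part of [Lam]. *)
have [k kk0 nsk] : exists2 k, (k0 <= k)%N & ~ small g (c1 * tau ^- k)
    [set l | Lam l /\ ~ small a (c0 * tau ^- k) (Ek k `&` F l)].
  apply: (small_pigeonhole g0 (ltW c10) sum1 _ nsLam).
  by move=> l Ll; have [k ? ?] := lineP l Ll; exists k.
have k3 : (3 <= k)%N by apply: leq_trans kk0.
have sizeY Y : uniq Y -> (forall y, y \in Y -> D (y, k)) ->
    (size Y)%:R <= sigma ^+ k.
  move=> uY YD.
  have h : (size Y)%:R * sigma ^- k <= sigma ^- k0 / 2.
    have -> : (size Y)%:R * sigma ^- k
        = \sum_(p <- [seq (y, k) | y <- Y]) sigma ^- p.2.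
      by rewrite big_map /= big_const_seq count_predT iter_addr_0 mulr_natl.
    apply: Dsum; first by rewrite map_inj_uniq // => y y' [].
    by move=> p /mapP[y /YD Dy ->].
  rewrite -[leRHS]mul1r -ler_pdivrMr ?exprn_gt0 //; apply: le_trans h _.
  have : sigma ^- k0 <= 1 by rewrite invf_le1 ?exprn_gt0 // exprn_ege1.
  move: e0; lra.
(* A longest list of centres of level [k] contains all of them. *)
have [Y [uY YD] Ymax] : exists2 Y, uniq Y /\ (forall y, y \in Y -> D (y, k)) &
    forall Y', uniq Y' /\ (forall y, y \in Y' -> D (y, k)) ->
      (size Y' <= size Y)%N.
  apply: (@exists_seq_max_size _ _ (Num.bound (sigma ^+ k))); first by exists [::].
  move=> s [us sD]; rewrite -(ler_nat R); apply: le_trans (sizeY s us sD) _.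
  by apply: ltW; apply: archi_boundP; rewrite exprn_ge0 // ltW.
have DY y : D (y, k) -> y \in Y.
  move=> Dy; apply: contraT => yY.
  have : uniq (y :: Y) /\ forall z, z \in y :: Y -> D (z, k).
    by split => [|z]; rewrite /= ?yY // inE => /orP[/eqP->|/YD].
  by move/Ymax; rewrite /= ltnn.
have /choice[phi phiP] : forall x, exists y, Ek k x ->
    y \in Y /\ `|y - x| <= 4 * 2 ^- k.
  move=> x; have [[y Dy yx]|nE] := pselect (Ek k x); last by exists 0.
  by exists y => _; split => //; exact: DY.
have ct c : 0 < c -> c <= 1 -> 0 < c * tau ^- k /\ c * tau ^- k <= 1.
  by move=> c0' c1'; rewrite mulr_gt0 //; split => //; rewrite mulr_ile1 // ltW.
have [L [uL LLam szL FL Lbig]] :=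
  discrete_frostman k g1 (ct c1 c10 c11).1 (ct c1 c10 c11).2 nsk.
have /choice[P PP] : forall l, exists P : seq V, l \in L ->
    [/\ (forall p, p \in P -> (Ek k `&` F l) p), frostman_seq a k P &
     c0 * tau ^- k / 2 * a ^+ k <= (size P)%:R].
  move=> l; have [lL|lL] := boolP (l \in L); last by exists [::].
  have [Ll nsl] := LLam l lL.
  have [P [uP PE szP FP Pbig]] :=
    discrete_frostman k a1 (ct c0 c00 c01).1 (ct c0 c00 c01).2 nsl.
  by exists P.
have := @sqr_sum_size_le R n i kappa rho kappa0 rho0 phi L P Y a g k B
  g1 ga k3 CB.
move=> /(_ _ _ uY _).
have h1 l : l \in L -> [/\ oriented_line i kappa l, frostman_seq a k (P l) &
     forall p, p \in P l -> bounded_line rho l p /\ `|phi p - p| <= 4 * 2 ^- k].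
  move=> lL; have [PE FP _] := PP l lL; split => //.
    exact: (LamP l (LLam l lL).1).1.
  by move=> p /PE[Ekp [_ pl]]; split => //; exact: (phiP p Ekp).2.
have h2 l p : l \in L -> p \in P l -> phi p \in Y.
  by move=> lL /(let: And3 PE _ _ := PP l lL in PE p)[Ekp _]; exact: (phiP p Ekp).1.
move=> /(_ h1 (conj szL FL) h2).
have Ssum : (size L)%:R * (c0 * tau ^- k / 2 * a ^+ k) <=
    \sum_(l <- L) (size (P l))%:R.
  have -> : (size L)%:R * (c0 * tau ^- k / 2 * a ^+ k) =
      \sum_(l <- L) (c0 * tau ^- k / 2 * a ^+ k).
    by rewrite big_const_seq count_predT iter_addr_0 mulr_natl.
  by rewrite big_seq [leRHS]big_seq; apply: ler_sum => l /PP[].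
have ak0 : 0 < a ^+ k by rewrite exprn_gt0.
have gk0 : 0 < g ^+ k by rewrite exprn_gt0.
have sk0 : 0 < sigma ^+ k by rewrite exprn_gt0.
have tk0 : 0 < tau ^+ k by rewrite exprn_gt0.
have szY := sizeY Y uY YD.
have agk : sigma ^+ k * (tau ^+ k) ^+ 4 <= a ^+ k * g ^+ k.
  by rewrite exprAC -!exprMn lerXn2r // nnegrE mulr_ge0 // ?exprn_ge0 // ltW.
have := growth k kk0.
have K0 : 0 < a ^+ (B + 4) * k.+2%:R by rewrite mulr_gt0 ?exprn_gt0 // ltr0n.
move: (a ^+ (B + 4) * k.+2%:R) K0 => K K0 Kgrowth CS.
move: (size Y)%:R szY CS => NY szY CS.
move: (size L)%:R Lbig Ssum CS => NL Lbig Ssum CS.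
move: (\sum_(l <- L) _) Ssum CS => S Ssum CS.
move: (g ^+ k) gk0 Lbig agk => G G0 Lbig agk.
move: (a ^+ k) ak0 Ssum CS agk => A A0 Ssum CS agk.
move: (sigma ^+ k) sk0 szY agk => Z Z0 szY agk.
move: (tau ^+ k) tk0 Lbig Ssum agk Kgrowth => T T0 Lbig Ssum agk Kgrowth.
have u0 : 0 < T^-1 by rewrite invr_gt0.
have NL0 : 0 < NL.
  by apply: lt_le_trans Lbig; rewrite mulr_gt0 // divr_gt0 // mulr_gt0.
pose w := c0 * T^-1 / 2 * A.
have w0 : 0 < w by rewrite mulr_gt0 // divr_gt0 // mulr_gt0.
(* Each of the [NL] lines carries at least [w] points, so [NL * w <= S]. One factor [NL] cancels in
   [CS]; the lower bound [Lbig] then replaces the other. *)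
have step1 : NL * w ^+ 2 <= Z * (K * A).
  rewrite -(ler_pM2l NL0).
  apply: le_trans (_ : S ^+ 2 <= _).
    have -> : NL * (NL * w ^+ 2) = (NL * w) ^+ 2 by ring.
    have NLw : 0 <= NL * w by rewrite mulr_ge0 // ltW.
    by rewrite lerXn2r // nnegrE // (le_trans NLw).
  apply: le_trans CS _; rewrite [leRHS]mulrCA ler_wpM2r //.
  by rewrite !mulr_ge0 // ltW.
have step2 : c1 * T^-1 / 2 * G * w ^+ 2 <= Z * (K * A).
  by apply: le_trans step1; rewrite ler_wpM2r // exprn_ge0 // ltW.
have step3 : c0 ^+ 2 * c1 / 8 * T^-1 ^+ 3 * (A * G) <= Z * K.
  rewrite -(ler_pM2r A0) -[leRHS]mulrA; apply: le_trans step2.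
  by rewrite le_eqVlt; apply/orP; left; apply/eqP; rewrite /w; field; rewrite gt_eqF.
have step4 : c0 ^+ 2 * c1 / 8 * T^-1 ^+ 3 * (Z * T ^+ 4) <= Z * K.
  apply: le_trans step3; apply: ler_wpM2l => //.
  by apply: mulr_ge0; [exact: ltW|rewrite exprn_ge0 // ltW].
have : Z * (c0 ^+ 2 * c1 / 8 * T) <= Z * K.
  apply: le_trans step4; rewrite le_eqVlt; apply/orP; left; apply/eqP.
  by field; rewrite gt_eqF.
by rewrite ler_pM2l // leNgt Kgrowth.
Qed.

End Furstenberg.

(** * Parametrization of the space of lines *)

Lemma small_null_bigcup (R : realType) (V : normedModType R) (I : countType)
    (b : R) (A : I -> set V) : 0 < b ->
  (forall i e, 0 < e -> small b e (A i)) ->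
  forall e, 0 < e -> small b e (\bigcup_i A i).
Proof.
move=> b0 sA e e0.
apply: (@small_sub _ _ _ _ _
    (\bigcup_k (if unpickle k is Some i then A i else set0))).
  by move=> x [i _ Aix]; exists (pickle i) => //; rewrite pickleK.
apply: (@small_bigcup _ _ _ (fun k => e * 2 ^- k.+1)) => // [k|M].
  have ek : 0 < e * 2 ^- k.+1 by rewrite mulr_gt0 // invr_gt0 exprn_gt0.
  case: (unpickle k) => [i|]; first exact: sA.
  exists set0 => // -[|p F] _ FD; first by rewrite big_nil ltW.
  by case: (FD p (mem_head _ _)).
by rewrite -mulr_sumr ler_piMr ?(ltW e0) ?sum_halfX.
Qed.

Section Lines.
Variables (R : realType) (n : nat).
Hypothesis n0 : (0 < n)%N.
Local Notation V := 'rV[R]_n.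

Lemma eucl_norm_ge0 (x : V) : 0 <= eucl_norm x.
Proof. exact: sqrtr_ge0. Qed.

Lemma exists_line_repr_gt0 (w : affine_line R n) : exists l : V * V,
  line_repr (line_points w) l.1 l.2 /\ exists i, 0 < l.1 0 i.
Proof.
have [e [v [e1 ev lE]]] := line_pointsP w.
have [i ei] : exists i, e 0 i != 0.
  apply: contrapT => no; have e0 : e = 0.
    apply/rowP => i; rewrite mxE; apply/eqP; apply: contraT => ei.
    by case: no; exists i.
  have /eqP := eucl_norm_eq1 e1.
  rewrite e0 /dot_product big1 => [|j _]; last by rewrite mxE mul0r.
  by rewrite eq_sym oner_eq0.
have [ei0|ei0] := ltP 0 (e 0 i); first by exists (e, v); split => //; exists i.
exists (- e, v); split => /=; last first.
  by exists i; rewrite mxE oppr_gt0 lt_def eq_sym ei.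
split.
- by rewrite /eucl_norm dot_productNl dot_productNr opprK.
- by rewrite dot_productNl ev oppr0.
- rewrite lE; apply/seteqP; split => [_ [t _ <-]|_ [t _ <-]];
    by exists (- t) => //; rewrite scaleNr scalerN ?opprK.
Qed.

Lemma line_dist_le (w w' : affine_line R n) (l l' : V * V) :
  line_repr (line_points w) l.1 l.2 -> line_repr (line_points w') l'.1 l'.2 ->
  line_dist w w' <= 2 * n%:R * `|l - l'|.
Proof.
move=> wl wl'; apply: le_trans (_ : eucl_dist l.1 l'.1 + eucl_dist l.2 l'.2 <= _).
  apply: ge_inf; last by exists l.1, l.2, l'.1, l'.2.
  by exists 0 => _ [e1 [v1 [e2 [v2 [_ _ ->]]]]]; rewrite addr_ge0 ?eucl_norm_ge0.
have h : `|l.1 - l'.1| <= `|l - l'| /\ `|l.2 - l'.2| <= `|l - l'|.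
  by rewrite [`|l - l'|]prod_normE /= !le_max !lexx orbT.
have h1 := eucl_norm_le (l.1 - l'.1); have h2 := eucl_norm_le (l.2 - l'.2).
have : n%:R * `|l.1 - l'.1| <= n%:R * `|l - l'| by rewrite ler_wpM2l ?h.1.
have : n%:R * `|l.2 - l'.2| <= n%:R * `|l - l'| by rewrite ler_wpM2l ?h.2.
rewrite /eucl_dist; lra.
Qed.

Lemma line_dist_ge0 (w w' : affine_line R n) : 0 <= line_dist w w'.
Proof.
have [l [wl _]] := exists_line_repr_gt0 w.
have [l' [wl' _]] := exists_line_repr_gt0 w'.
apply: lb_le_inf.
  by exists (eucl_dist l.1 l'.1 + eucl_dist l.2 l'.2), l.1, l.2, l'.1, l'.2.
by move=> _ [e1 [v1 [e2 [v2 [_ _ ->]]]]]; rewrite addr_ge0 ?eucl_norm_ge0.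
Qed.

(** The line is exhausted by bounded pieces, and a countable union of null pieces would be null.
    Constants indexed by [nat] keep the later decomposition of the set of lines countable. *)
Lemma exists_bounded_line_not_small (alpha : R) (E : set V)
    (w : affine_line R n) (l : V * V) : 0 < alpha ->
  line_repr (line_points w) l.1 l.2 ->
  (0 < hausdorff_measure eucl_dist alpha (E `&` line_points w))%E ->
  exists m k : nat,
    ~ small (2 `^ alpha) (2 ^- k) (E `&` bounded_line m%:R l).
Proof.
move=> alpha0 [_ _ wE] /lt_geF/negP H; apply: contrapT => allsmall; apply: H.
have n0R : 0 < n%:R :> R by rewrite ltr0n.
apply: (@hausdorff_measure_le0 _ _ _ _ id _ n%:R) => //.
- by move=> x y; exact: eucl_norm_ge0.
- by move=> x y _ _; exact: eucl_norm_le.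
move=> e e0; rewrite image_id.
apply: (@small_sub _ _ _ _ _ (\bigcup_m (E `&` bounded_line m%:R l))).
  move=> x [Ex]; rewrite wE => -[t _ tx]; exists (Num.bound `|x|) => //.
  split => //; split; first by exists t.
  by apply: ltW; exact: archi_boundP.
move: e e0; apply: small_null_bigcup; first by rewrite powR_gt0.
move=> m e e0; have [k ke] := exists_halfX_lt e0.
apply: (small_le (ltW ke)); apply: contrapT => ns; apply: allsmall.
by exists m, k.
Qed.

End Lines.

(** * The dimension bound *)

Theorem theoremA1 (R : realType) (n : nat) (alpha beta : R)
    (E : set 'rV[R]_n)
    (hn : (2 <= n)%N)
    (halpha0 : 0 < alpha) (halpha1 : alpha <= 1)
    (hbeta0 : 0 < beta) (hbeta1 : beta <= 2 * n%:R - 2)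
    (hE : furstenberg_set alpha beta E) :
  ((alpha + Num.min beta alpha)%:E <= hausdorff_dim eucl_dist E)%E.
Proof.
have n0 : (0 < n)%N by apply: ltnW.
have [L [L0 LE]] := hE.
rewrite leNgt; apply/negP => /ereal_inf_lt[_ [s [s0 Hs] <-]].
set t := alpha + _; rewrite lte_fin => st.
pose gamma := Num.min beta alpha.
have gamma0 : 0 < gamma by rewrite lt_min hbeta0.
have gamma_alpha : gamma <= alpha by rewrite ge_min lexx orbT.
have gamma_beta : gamma <= beta by rewrite ge_min lexx.
have pow_le (x y : R) : x <= y -> 2 `^ x <= 2 `^ y :> R.
  by move=> xy; rewrite ler_powR ?ler1n.
have pow_gt0 (x : R) : 0 < 2 `^ x :> R by rewrite powR_gt0.
pose a : R := 2 `^ alpha; pose g : R := 2 `^ gamma.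
(* Then [s' + 4 * eta = t = alpha + gamma], so the exponents in [sigag] balance exactly. *)
pose s' := (s + t) / 2; pose eta := (t - s') / 4.
have ss' : s <= s' by rewrite /s'; lra.
have s's : s' < t by rewrite /s'; lra.
have eta0 : 0 < eta by rewrite divr_gt0 // subr_gt0.
have tau1 : 1 < 2 `^ eta :> R.
  have : 1 `^ eta < 2 `^ eta :> R by apply: gt0_ltr_powR; rewrite ?nnegrE ?ltr1n.
  by rewrite powR1.
have sigag : 2 `^ s' * (2 `^ eta) ^+ 4 <= a * g.
  rewrite -powR_mulrn ?powR_ge0 // -powRrM -!powRD; last first.
  - by rewrite pnatr_eq0 implybT.
  - by rewrite pnatr_eq0 implybT.
  by apply: pow_le; rewrite /eta -/t /gamma -/t; lra.
have sE e : 0 < e -> small (2 `^ s') e E.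
  move=> e0; apply: (small_leb (pow_gt0 s) (pow_le _ _ ss')).
  apply: (small_of_hausdorff_measure_eq0 s0 _ Hs) => //.
  by move=> x y; exact: normr_le_eucl_norm.
have /choice[rep repP] := @exists_line_repr_gt0 R n.
suff /le_lt_trans/(_ L0) : (hausdorff_measure (@line_dist R n) beta L <= 0)%E.
  by rewrite ltxx.
apply: (@hausdorff_measure_le0 _ _ _ _ rep _ (2 * n%:R)) => //.
- by rewrite mulr_gt0 // ltr0n.
- exact: line_dist_ge0.
- by move=> w w' _ _; apply: line_dist_le; exact: (repP _).1.
move=> e e0; apply: (small_leb (pow_gt0 gamma) (pow_le _ _ gamma_beta)).
(* The constants required by [small_lines] vary with the line. They are uniform on each of countably
   many classes that cover the family: [i] and [2 ^- j] give the orientation, [m] the radius,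
   [2 ^- k] the content. *)
pose Lam (q : 'I_n * nat * (nat * nat)) : set ('rV[R]_n * 'rV[R]_n) :=
  [set l | oriented_line q.1.1 (2 ^- q.1.2) l /\
     ~ small a (2 ^- q.2.2) (E `&` bounded_line q.2.1%:R l)].
apply: (@small_sub _ _ _ _ _ (\bigcup_q Lam q)).
  move=> _ [w Lw <-]; have [wl [i ei]] := repP w.
  have [m [k mk]] := exists_bounded_line_not_small n0 halpha0 wl (LE w Lw).
  have [j /ltW ej] := exists_halfX_lt ei.
  by exists (i, j, (m, k)) => //; split => //=; have [] := wl; split.
move: e e0; apply: small_null_bigcup => // -[[i j] [m k]] e e0.
have h0 r : 0 < (2 : R) ^- r by rewrite invr_gt0 exprn_gt0.
apply: (@small_le _ _ _ (Num.min e 1)); first by rewrite ge_min lexx.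
apply: (@small_lines _ _ i (2 ^- j) m%:R _ _ a g (2 `^ s') (2 `^ eta) (2 ^- k)
  _ E) => //.
- exact/powR2_ge1/ltW.
- exact: pow_le.
- by apply: powR2_ge1; apply: le_trans ss'.
- by rewrite invf_le1 ?exprn_gt0 // exprn_ege1 // ler1n.
- by rewrite lt_min e0 ltr01.
- by rewrite ge_min lexx orbT.
Qed.
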